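(* Let $X$ be a discrete metric space of bounded geometry, and let $X_1\subseteq X_2\subseteq X_3\subseteq\cdots$ be an increasing sequence of bounded subspaces of $X$ with $X=\bigcup_{n=1}^\infty X_n$. Assume also that any bounded subset of $X$ is contained in some $X_n$. If the family $\{X_n\}_{n\ge1}$ has property A uniformly, then $X$ has property A.
   Context: A discrete metric space $X$ has bounded geometry if for all $r>0$ there exists $N_r$ such that $|B(x,r)|<N_r$ for all $x\in X$. A discrete metric space $(X,d)$ has property A if for all $R,\epsilon>0$ there exists a family $\{A_x\}_{x\in X}$ of finite, non-empty subsets of $X\times\mathbb{N}$ such that (i) for all $x,y\in X$ with $d(x,y)\le R$ we have $\frac{|A_x\triangle A_y|}{|A_x\cap A_y|}<\epsilon$; (ii) there exists $S$ such that for each $x\in X$, if $(y,n)\in A_x$ then $d(x,y)\le S$. A partition of unity on $X$ subordinate to a cover $\{U_i\}_{i\in I}$ is a collection of functions $\phi_i:X\to[0,1]$ (no continuity required), with $\phi_i$ supported in $U_i$ and $\sum_i\phi_i(x)=1$ for all $x\in X$. The diameter of a subset $U\subseteq X$ is $\sup\{d(x,y):x,y\in U\}$. A family $\{X_i\}_{i\in I}$ of metric spaces has property A uniformly (equi-property A) if for all $R,\epsilon>0$ there exists $S>0$ such that for every $i\in I$ there are a cover $\mathcal{U}_i=\{U_i^j\}_{j\in J_i}$ of $X_i$ by sets of diameter at most $S$ and a partition of unity $\{\phi_i^j\}_{j\in J_i}$ on $X_i$ subordinate to $\mathcal{U}_i$ such that $\sum_{j\in J_i}|\phi_i^j(x)-\phi_i^j(y)|<\epsilon$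 whenever $x,y\in X_i$ and $d(x,y)\le R$. *)

(* Defs.v *)
From HB Require Import structures.
From mathcomp Require Import all_boot all_order all_algebra finmap.
From mathcomp Require Import all_classical all_reals all_analysis.

Set Implicit Arguments.
Unset Strict Implicit.
Unset Printing Implicit Defensive.

Import Order.TTheory GRing.Theory Num.Theory.

Local Open Scope classical_set_scope.
Local Open Scope ring_scope.

(* MathComp-Analysis only provides the pseudometric structure on the subtype
   [set_type A] of a subset [A]; the next instance adds the restricted
   distance, so that [A : metricType R] is [A] as a metric subspace. *)
Section metric_subspace.
Context {R : realType} {X : metricType R} (A : set X).

Let sub_mdist (x y : set_type A) : R := mdist (\val x) (\val y).

Let sub_mdist_ge0 x y : 0 <= sub_mdist x y.
Proof. exact: mdist_ge0. Qed.

Let sub_mdist_positivity x y : sub_mdist x y = 0 -> x = y.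
Proof. by move=> /mdist_positivity xy; apply: val_inj. Qed.

Let sub_ballEmdist (x : set_type A) (d : R) :
  ball x d = [set y | sub_mdist x y < d].
Proof. by rewrite -initial_ballE ballEmdist. Qed.

HB.instance Definition _ := PseudoMetric_isMetric.Build R (set_type A)
  sub_mdist_ge0 sub_mdist_positivity sub_ballEmdist.

Lemma mdist_set_type (x y : set_type A) : mdist x y = mdist (\val x) (\val y).
Proof. by []. Qed.

End metric_subspace.

Section coarse_geometry.
Context {R : realType}.

(* Discreteness is topological: distances need not be bounded below, unlike
   for [discretePseudoMetricType], where all balls are singletons. *)
Definition discrete_metric_space (X : metricType R) : Prop :=
  forall x : X, open [set x].

(* The finiteness clause is needed since [fset_set] is empty on infinite sets. *)
Definition bounded_geometry (X : metricType R) : Prop :=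
  forall r : R, 0 < r -> exists N : nat, forall x : X,
    finite_set (ball x r) /\ (#|` fset_set (ball x r)| < N)%N.

(* The diameter of the empty set is [-oo]. *)
Definition diameter (X : metricType R) (A : set X) : \bar R :=
  ereal_sup [set (mdist x y)%:E | x in A & y in A].

Definition metric_bounded (X : metricType R) (A : set X) : Prop :=
  (diameter A < +oo)%E.

Definition fsymdiff (T : choiceType) (A B : {fset T}) : {fset T} :=
  ((A `\` B) `|` (B `\` A))%fset.

(* Division by 0 yields 0 in [R], so the intersection is required to be
   nonempty: for disjoint nonempty sets the quotient is infinite. *)
Definition property_A (X : metricType R) : Prop :=
  forall r e : R, 0 < r -> 0 < e ->
  exists A : X -> {fset (X * nat)},
  [/\ forall x, A x != fset0,
      forall x y, mdist x y <= r ->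
        (0 < #|` (A x `&` A y)%fset|)%N /\
        #|` fsymdiff (A x) (A y)|%:R / #|` (A x `&` A y)%fset|%:R < e
    & exists S : R, forall x y n, (y, n) \in A x -> mdist x y <= S].

Definition partition_of_unity (X : metricType R) (J : choiceType)
    (U : J -> set X) (phi : J -> X -> R) : Prop :=
  [/\ forall j x, 0 <= phi j x <= 1,
      forall j, [set x | phi j x != 0] `<=` U j
    & forall x, \esum_(j in [set: J]) (phi j x)%:E = 1%E].

Definition equi_property_A (I : Type) (X_ : I -> metricType R) : Prop :=
  forall r e : R, 0 < r -> 0 < e ->
  exists2 S : R, 0 < S & forall i : I,
  exists (J : choiceType) (U : J -> set (X_ i)) (phi : J -> X_ i -> R),
  [/\ cover [set: J] U = [set: X_ i],
      forall j, (diameter (U j) <= S%:E)%E,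
      partition_of_unity U phi
    & forall x y : X_ i, mdist x y <= r ->
        (\esum_(j in [set: J]) (`|phi j x - phi j y|)%:E < e%:E)%E].

End coarse_geometry.

(* Main.v *)
(* Collapse each piece of the partition of unity on X_n to one of its points.
   This turns the partition into a family of probability measures f_x on X, with
   f_x supported in a ball of uniformly bounded cardinality and radius about x,
   and f_x, f_y close in l^1 for x, y close.  Taking the region below the graph
   of floor(M f_x), for M large and independent of n, gives the sets of
   property A for X_n, all confined to a finite subset of X x N depending only
   on x.  By pigeonhole they stabilise along an ultrafilter on the indices n, and
   the stable values are the required sets for X. *)
Require Import Defs.
From mathcomp Require Import all_boot all_order all_algebra finmap.
From mathcomp Require Import all_classical all_reals all_analysis.
From mathcomp Require Import zify lra.

Import Order.TTheory GRing.Theory Num.Theory.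

Local Open Scope classical_set_scope.
Local Open Scope ring_scope.

(** * Regions between graphs of functions to the naturals *)

Section band.
Context {T : choiceType}.
Implicit Types (D B : {fset T}) (g h : T -> nat).

(** Truncated subtraction empties the fibre wherever [g z <= h z], so a difference of subgraphs is a
    band with no order assumed between [g] and [h]. *)
Definition band D h g : {fset T * nat} :=
  [fset u in [seq (z, k) | z <- D, k <- iota (h z) (g z - h z)]]%fset.

Lemma in_band D h g z k :
  ((z, k) \in band D h g) = [&& z \in D, (h z <= k)%N & (k < g z)%N].
Proof.
rewrite inE /=; apply/allpairsPdep/and3P => [[x [n [xD + [-> ->]]]]|[zD hk kg]].
  by rewrite mem_iota; split=> //; lia.
by exists z, k; split=> //; rewrite mem_iota; lia.
Qed.

Lemma card_band D h g : #|` band D h g| = (\sum_(z <- D) (g z - h z))%N.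
Proof.
rewrite card_fseq undup_id; last first.
  apply: allpairs_uniq_dep => [|z _|[z k] [z' k'] _ _ /= [-> ->]//].
    exact: fset_uniq.
  exact: iota_uniq.
rewrite size_allpairs_dep sumnE big_map.
by apply: eq_bigr => z _; rewrite size_iota.
Qed.

Definition subgraph D g := band D (fun=> 0%N) g.

Lemma subgraph_fsetD D g h : (subgraph D g `\` subgraph D h)%fset = band D h g.
Proof.
apply/fsetP => -[z k]; rewrite inE !in_band.
by case: (z \in D) => //=; rewrite -leqNgt.
Qed.

(** Lets sets built over two different bases be compared over a common one. *)
Lemma subgraph_widen B D g : (B `<=` D)%fset ->
  {in D, forall z, z \notin B -> g z = 0%N} -> subgraph B g = subgraph D g.
Proof.
move=> /fsubsetP BD g0; apply/fsetP => -[z k]; rewrite !in_band.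
case: (boolP (z \in B)) => [/BD ->//|zB] /=.
by case: (boolP (z \in D)) => //= zD; rewrite g0.
Qed.

Lemma subgraph_sub D g M : (forall z, g z <= M)%N ->
  (subgraph D g `<=` subgraph D (fun=> M))%fset.
Proof.
move=> gM; apply/fsubsetP => -[z k]; rewrite !in_band => /and3P[-> _ /= kg].
exact: leq_trans kg (gM z).
Qed.

End band.

(** * Pushforward of weights along a map *)

Section mass.
Context {R : realType} {J T : choiceType} (p : J -> T).
Implicit Types (a b : J -> R) (D : {fset T}).

(** The pushforward of [a] under [p]; for weights of total 1, [fine] loses nothing. *)
Definition mass a z : R :=
  fine (\esum_(j in [set: J]) (if p j == z then (a j)%:E else 0%E)).

Definition probability_weights a :=
  (forall j, 0 <= a j) /\ \esum_(j in [set: J]) (a j)%:E = 1%E.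

Lemma massE a z : probability_weights a ->
  (mass a z)%:E = \esum_(j in [set: J]) (if p j == z then (a j)%:E else 0%E).
Proof.
move=> [a0 a1]; rewrite fineK// ge0_fin_numE; last first.
  by apply: esum_ge0 => j _; case: ifP => // _; rewrite lee_fin.
apply: (@le_lt_trans _ _ 1%E); last exact: ltry.
by rewrite -a1; apply: le_esum => j _; case: ifP => // _; rewrite lee_fin.
Qed.

Lemma mass_ge0 a z : probability_weights a -> 0 <= mass a z.
Proof.
move=> aP; rewrite -lee_fin massE//; apply: esum_ge0 => j _.
by case: ifP => // _; rewrite lee_fin aP.1.
Qed.

Lemma mass_le1 a z : probability_weights a -> mass a z <= 1.
Proof.
move=> aP; rewrite -lee_fin massE// -aP.2; apply: le_esum => j _.
by case: ifP => // _; rewrite lee_fin aP.1.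
Qed.

Lemma mass_notin a D z : (forall j, a j != 0 -> p j \in D) -> z \notin D ->
  mass a z = 0.
Proof.
move=> aD zD; rewrite /mass esum1// => j _; case: eqP => // pj; congr _%:E.
by apply/eqP; apply: contraNT zD => /aD; rewrite pj.
Qed.

(** Nonnegativity permits swapping the sums; each [j] then contributes only at [z = p j], which
    occurs at most once in [D]. *)
Lemma sum_esum_fibre D (c : J -> \bar R) : (forall j, (0 <= c j)%E) ->
  (\sum_(z <- D) \esum_(j in [set: J]) (if p j == z then c j else 0) =
   \esum_(j in [set: J]) (if p j \in D then c j else 0))%E.
Proof.
move=> c0; rewrite -esum_sum => [|j z _ _]; last by case: ifP.
apply: eq_esum => j _; case: ifPn => pj.
  rewrite (big_fsetD1 _ pj)/= eqxx big1_fset ?adde0// => z.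
  by rewrite !inE eq_sym => /andP[/negbTE ->].
rewrite big1_fset// => z zD _; case: eqP => // pjz.
by rewrite pjz zD in pj.
Qed.

Lemma sum_mass a D : probability_weights a ->
  (forall j, a j != 0 -> p j \in D) -> \sum_(z <- D) mass a z = 1.
Proof.
move=> aP aD; apply/eqP; rewrite -eqe -sumEFin; apply/eqP.
under eq_bigr do rewrite massE//.
rewrite (sum_esum_fibre D (fun j => (a j)%:E)) => [|j]; last first.
  by rewrite lee_fin aP.1.
rewrite -aP.2; apply: eq_esum => j _; case: ifPn => // pj; congr _%:E.
by apply/esym/eqP; apply: contraNT pj => /aD.
Qed.

Lemma dist_mass a b z : probability_weights a -> probability_weights b ->
  (`|mass a z - mass b z|%:E <=
   \esum_(j in [set: J]) (if p j == z then `|a j - b j|%:E else 0))%E.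
Proof.
(* The triangle inequality is kept in additive form, which avoids subtracting extended reals. *)
have side u v : probability_weights u -> probability_weights v ->
    ((mass u z)%:E <= (mass v z)%:E +
     \esum_(j in [set: J]) (if p j == z then `|u j - v j|%:E else 0))%E.
  move=> uP vP; rewrite !massE// -esumD; last 2 first.
  - by move=> j _; case: ifP => // _; rewrite lee_fin vP.1.
  - by move=> j _; case: ifP => // _; rewrite lee_fin.
  apply: le_esum => j _; case: ifP => // _; last by rewrite adde0.
  by rewrite -EFinD lee_fin -lerBlDl ler_norm.
move=> aP bP; have := side a b aP bP; have := side b a bP aP.
under eq_esum do rewrite distrC.
case: (\esum_(_ in _) _)%E => [e| |]; rewrite ?leey//.
rewrite -!EFinD !lee_fin => ba ab.
by rewrite ler_distl; apply/andP; split; lra.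
Qed.

(** Pushforward contracts the l^1 distance because the fibres of [p] are disjoint. *)
Lemma sum_dist_mass a b D e : probability_weights a -> probability_weights b ->
  (\esum_(j in [set: J]) `|a j - b j|%:E <= e%:E)%E ->
  \sum_(z <- D) `|mass a z - mass b z| <= e.
Proof.
move=> aP bP abe; rewrite -lee_fin -sumEFin; apply: le_trans abe.
apply: le_trans.
  by apply: lee_sum => z _; apply: dist_mass.
rewrite (sum_esum_fibre D (fun j => `|a j - b j|%:E)) => [|j]; last first.
  by rewrite lee_fin.
by apply: le_esum => j _; case: ifP => // _; rewrite lee_fin.
Qed.

End mass.

(** * Rounding weights to finite sets *)

Section quantization.
Context {R : realType} {J T : choiceType} (p : J -> T) (M : nat).
Implicit Types (a b : J -> R) (B C D : {fset T}).

Definition height a z := Num.truncn (M%:R * mass p a z).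

Definition quantization a B := subgraph B (height a).

Lemma height_itv a z : probability_weights a ->
  (height a z)%:R <= M%:R * mass p a z < (height a z)%:R + 1.
Proof.
move=> aP; rewrite natr1; apply: truncn_itv.
by rewrite mulr_ge0// mass_ge0.
Qed.

Lemma height_le a z : probability_weights a -> (height a z <= M)%N.
Proof.
move=> aP; rewrite -(ler_nat R).
have /andP[/le_trans-> //] := height_itv a z aP.
by rewrite ler_piMr// mass_le1.
Qed.

Lemma sum_nat1 D : \sum_(z <- D) (1 : R) = #|` D|%:R.
Proof. by rewrite card_fset_sum1 natr_sum. Qed.

(** Rounding down loses less than 1 at each point of [D], out of a total of [M]. *)
Lemma card_quantization a D : probability_weights a ->
  (forall j, a j != 0 -> p j \in D) ->
  M%:R - #|` D|%:R <= #|` quantization a D|%:R :> R.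
Proof.
move=> aP aD; rewrite card_band natr_sum -[M%:R in leLHS]mulr1.
rewrite -[X in _ * X - _](sum_mass _ _ _ aP aD) mulr_sumr -sum_nat1.
rewrite -sumrB; apply: ler_sum => z _.
by have := height_itv a z aP; rewrite subn0; lra.
Qed.

Lemma card_quantization_symdiff a b D e :
  probability_weights a -> probability_weights b ->
  (\esum_(j in [set: J]) `|a j - b j|%:E <= e%:E)%E ->
  #|` fsymdiff (quantization a D) (quantization b D)|%:R
    <= M%:R * e + #|` D|%:R.
Proof.
move=> aP bP abe.
apply: (@le_trans _ _ (#|` band D (height b) (height a)| +
                       #|` band D (height a) (height b)|)%:R).
  by rewrite ler_nat /fsymdiff !subgraph_fsetD leq_card_fsetU.
rewrite !card_band -big_split/= natr_sum.
apply: (@le_trans _ _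
  (\sum_(z <- D) (M%:R * `|mass p a z - mass p b z| + 1))).
  apply: ler_sum => z _.
  have := height_itv a z aP; have := height_itv b z bP.
  have <- : `|M%:R * mass p a z - M%:R * mass p b z| =
      M%:R * `|mass p a z - mass p b z|.
    by rewrite -mulrBr normrM normr_nat.
  (* Over each [z] one of the two bands is empty; the height of the other exceeds the gap before
     rounding by less than 1. *)
  have [hab|/ltnW hba] := leqP (height a z) (height b z).
    rewrite (eqP hab) add0n natrB// distrC.
    have := ler_norm (M%:R * mass p b z - M%:R * mass p a z); lra.
  rewrite (eqP hba) addn0 natrB//.
  have := ler_norm (M%:R * mass p a z - M%:R * mass p b z); lra.
rewrite big_split/= sum_nat1 lerD2r -mulr_sumr ler_wpM2l//.
exact: sum_dist_mass.
Qed.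

Lemma quantization_widen a B D : (forall j, a j != 0 -> p j \in B) ->
  (B `<=` D)%fset -> quantization a B = quantization a D.
Proof.
move=> aB BD; apply: subgraph_widen => // z _ zB.
by rewrite /height (mass_notin _ _ _ _ aB zB) mulr0 truncn0.
Qed.

(* With d = min(1/6, e/5) and 2 N <= M d, the symmetric difference has at most
   2 M d points and the intersection at least M (1 - 3 d) >= M / 2. *)
Lemma quantization_ratio a b B C (N : nat) e :
  probability_weights a -> probability_weights b ->
  (forall j, a j != 0 -> p j \in B) -> (forall j, b j != 0 -> p j \in C) ->
  (#|` B| <= N)%N -> (#|` C| <= N)%N -> 0 < e -> (0 < M)%N ->
  (\esum_(j in [set: J]) `|a j - b j|%:E <= (Num.min (1/6) (e/5))%:E)%E ->
  2 * N%:R <= M%:R * Num.min (1/6) (e/5) ->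
  (0 < #|` (quantization a B `&` quantization b C)%fset|)%N /\
  #|` fsymdiff (quantization a B) (quantization b C)|%:R /
  #|` (quantization a B `&` quantization b C)%fset|%:R < e.
Proof.
move=> aP bP aB bC BN CN e0 M0 abe NM; pose D := (B `|` C)%fset.
have BD : (B `<=` D)%fset := fsubsetUl B C.
have CD : (C `<=` D)%fset := fsubsetUr B C.
rewrite (quantization_widen _ _ _ aB BD) (quantization_widen _ _ _ bC CD).
have aD j : a j != 0 -> p j \in D by move=> /aB; exact: (fsubsetP BD).
have cA := card_quantization _ _ aP aD.
have cS := card_quantization_symdiff _ _ D _ aP bP abe.
set d := Num.min _ _ in abe NM cS.
set A := quantization a D in cA cS *; set A' := quantization b D in cS *.
have cI : #|` A|%:R <= #|` (A `&` A')%fset|%:R + #|` fsymdiff A A'|%:R :> R.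
  rewrite -natrD ler_nat -(cardfsID A' A) leq_add2l.
  by apply: fsubset_leq_card; exact: fsubsetUl.
have cD : #|` D|%:R <= 2 * N%:R :> R.
  rewrite -natrM ler_nat; apply: leq_trans (leq_card_fsetU B C) _; lia.
have M0' : 0 < M%:R :> R by rewrite ltr0n.
have d6 : d <= 1/6 by rewrite ge_min lexx.
have de : d <= e/5 by rewrite ge_min lexx orbT.
have Md6 : M%:R * d <= M%:R * (1/6) by rewrite ler_wpM2l// ltW.
have Mde : M%:R * d <= M%:R * e / 5 by rewrite -mulrA ler_wpM2l// ltW.
have I0 : M%:R / 2 <= #|` (A `&` A')%fset|%:R :> R by lra.
have I1 : 0 < #|` (A `&` A')%fset|%:R :> R by lra.
split; first by rewrite -(ltr0n R).
rewrite ltr_pdivrMr//.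
(* The symmetric difference has at most [2 M d <= (2/5) M e] points, which is strictly below
   [e * (M / 2)]. *)
have : e * (M%:R / 2) <= e * #|` (A `&` A')%fset|%:R by rewrite ler_wpM2l// ltW.
have : 0 < M%:R * e by rewrite mulr_gt0.
lra.
Qed.

End quantization.

(** * From the subspaces to the whole space *)

Lemma ultrafilter_pigeonhole (I : Type) (T : choiceType)
    (F : set_system I) (s : seq T) (f : I -> T) : UltraFilter F ->
  (\forall i \near F, f i \in s) -> exists t, \forall i \near F, f i = t.
Proof.
move=> UF; elim: s => [/filter_ex[]//|t s IHs fts].
(* Either [f = t] holds along [F], or its negation does and [f] falls in the shorter list. *)
have [ft|fNt] := in_ultra_setVsetC [set i | f i = t] UF; first by exists t.
apply: IHs; apply: filterS2 fts fNt => i /=.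
by rewrite inE => /orP[/eqP|].
Qed.

(** The sets are confined by [B x] and [M], which do not involve [Y]; this feeds the pigeonhole as
    [Y] runs over the subspaces. *)
Lemma partition_quantization {R : realType} {X : metricType R} (x0 : X)
    (Y : set X) (J : choiceType) (U : J -> set Y) (phi : J -> Y -> R)
    (B : X -> {fset X}) (r S e : R) (N M : nat) :
  (forall x y, mdist x y <= S -> y \in B x) ->
  (forall x, (#|` B x| <= N)%N) -> 0 < e -> (0 < M)%N ->
  2 * N%:R <= M%:R * Num.min (1/6) (e/5) ->
  (forall j, (diameter (U j) <= S%:E)%E) ->
  partition_of_unity U phi ->
  (forall x y : Y, mdist x y <= r ->
    (\esum_(j in [set: J]) `|phi j x - phi j y|%:E <
     (Num.min (1/6) (e/5))%:E)%E) ->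
  exists2 A : X -> {fset X * nat},
    forall x, (A x `<=` subgraph (B x) (fun=> M))%fset &
    forall x y, Y x -> Y y -> mdist x y <= r ->
      (0 < #|` (A x `&` A y)%fset|)%N /\
      #|` fsymdiff (A x) (A y)|%:R / #|` (A x `&` A y)%fset|%:R < e.
Proof.
move=> SB BN e0 M0 NM US [phi01 phiU phi1] phie.
(* An empty [U j] gets the dummy point [x0], harmlessly: [phi j] then vanishes. *)
have /choice[p pU] j : exists z : X, forall y : Y, U j y ->
    exists2 u : Y, U j u & z = \val u.
  have [[u Uu]|Ue] := pselect (exists u, U j u); first by exists (\val u), u.
  by exists x0 => y Uy; case: Ue; exists y.
pose w x j : R := if insub x is Some y then phi j y else 0.
have wE (y : Y) j : w (\val y) j = phi j y by rewrite /w valK.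
have wP (y : Y) : probability_weights (w (\val y)).
  split=> [j|]; first by rewrite wE; case/andP: (phi01 j y).
  by rewrite -(phi1 y); apply: eq_esum => j _; rewrite wE.
have wB (y : Y) j : w (\val y) j != 0 -> p j \in B (\val y).
  (* The point [y] and the chosen point [p j] both lie in [U j], of diameter at most [S]. *)
  rewrite wE => /phiU Uy; have [u Uu ->] := pU j y Uy; apply: SB.
  rewrite -mdist_set_type -lee_fin; apply: le_trans (US j).
  by apply: ereal_sup_ubound; exists y => //; exists u.
exists (fun x => if x \in Y then quantization p M (w x) (B x) else fset0).
  move=> x; case: ifPn => [xY|_]; last exact: fsub0set.
  by apply: subgraph_sub => z; apply: height_le; apply: (wP (Sub x xY)).
move=> x y /mem_set xY /mem_set yY xyr; rewrite xY yY.
pose x' : Y := Sub x xY; pose y' : Y := Sub y yY.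
apply: (@quantization_ratio _ _ _ p M (w x) (w y) (B x) (B y) N) => //.
- exact: wP x'.
- exact: wP y'.
- exact: wB x'.
- exact: wB y'.
apply: le_trans (ltW (phie x' y' xyr)).
by apply: le_esum => j _; rewrite -!wE.
Qed.

Theorem corollary2p2p9 (R : realType) (X : metricType R) (X_ : nat -> set X)
    (X_discrete : discrete_metric_space X)
    (X_bounded_geometry : bounded_geometry X)
    (X_incr : forall n, X_ n `<=` X_ n.+1)
    (X_bounded : forall n, metric_bounded (X_ n))
    (X_exhaust : \bigcup_n X_ n = [set: X])
    (X_absorb : forall B : set X, metric_bounded B -> exists n, B `<=` X_ n)
    (X_equiA : equi_property_A (fun n => X_ n : metricType R)) :
  property_A X.
Proof.
move=> r e r0 e0.
have [[x0 _]|X0] := pselect (exists x : X, True); last first.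
  by exists (fun=> fset0); split=> [x|x|]; [case: X0; exists x..|exists 0].
pose d : R := Num.min (1/6) (e/5).
have d0 : 0 < d by rewrite /d lt_min; apply/andP; split; lra.
have [S S0 XS] := X_equiA r d r0 d0.
(* Balls are open, so the radius [S + 1] is used to include distance exactly [S]. *)
have S1 : 0 < S + 1 by lra.
have [N BN] := X_bounded_geometry _ S1.
(* Large enough that rounding errors are small relative to [M], and fixed before [n]. *)
pose M := (Num.truncn (2 * N%:R / d)).+1.
have NM : 2 * N%:R <= M%:R * d.
  by rewrite -ler_pdivrMr// ltW// truncnS_gt.
pose B (x : X) := fset_set (ball x (S + 1)).
have inB x y : (y \in B x) = (mdist x y < S + 1).
  have [Bfin _] := BN x.
  by rewrite in_fset_set// ballEmdist; apply/idP/idP; rewrite inE.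
have /choice[A_ AP] n : exists A : X -> {fset X * nat},
    (forall x, (A x `<=` subgraph (B x) (fun=> M))%fset) /\
    forall x y, X_ n x -> X_ n y -> mdist x y <= r ->
      (0 < #|` (A x `&` A y)%fset|)%N /\
      #|` fsymdiff (A x) (A y)|%:R / #|` (A x `&` A y)%fset|%:R < e.
  have [J [U [phi [_ US phiP phid]]]] := XS n.
  have SB x y : mdist x y <= S -> y \in B x by rewrite inB; lra.
  have cardB x : (#|` B x| <= N)%N by apply: ltnW; case: (BN x).
  have [A AB Ae] := partition_quantization x0 (X_ n) _ U phi B r S e N M
    SB cardB e0 (ltn0Sn _) NM US phiP phid.
  by exists A.
have [F [UF Foo]] := ultraFilterLemma (F := \oo) _.
(* For fixed [x], every [A_ n x] belongs to one finite powerset independent of [n]. *)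
have /choice[A AF] x : exists t, \forall n \near F, A_ n x = t.
  apply: (ultrafilter_pigeonhole _ _ _ (fpowerset (subgraph (B x) (fun=> M)))).
  by near=> n; rewrite fpowersetE; case: (AP n).
have XF x : \forall n \near F, X_ n x.
  have [m _ Xm] : (\bigcup_n X_ n) x by rewrite X_exhaust.
  apply: Foo; exists m => // n /= mn.
  have: {homo X_ : i j / (i <= j)%N >-> i `<=` j}.
    apply: homo_leq => [Z//|Y Z W ZY YW z /ZY /YW//|//].
  by move=> /(_ _ _ mn); apply.
have Ae x y : mdist x y <= r -> (0 < #|` (A x `&` A y)%fset|)%N /\
    #|` fsymdiff (A x) (A y)|%:R / #|` (A x `&` A y)%fset|%:R < e.
  move=> xyr.
  (* Four events along [F] meet at some [n], whose estimate for [A_ n] passes to [A]. *)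
  have [n [[<- <-] [Xx Xy]]] : exists n, (A_ n x = A x /\ A_ n y = A y) /\
      (X_ n x /\ X_ n y).
    apply: (@filter_ex _ F); near=> n; split; split; near: n.
    - exact: AF.
    - exact: AF.
    - exact: XF.
    - exact: XF.
  exact: (AP n).2.
exists A; split=> // [x|].
  (* Nonemptiness of [A x] is the intersection clause applied to the pair [x], [x]. *)
  have [|+ _] := Ae x x; first by rewrite mdistxx ltW.
  by rewrite fsetIid cardfs_gt0.
exists (S + 1) => x y k.
have [n <-] := filter_ex (AF x).
move=> /(fsubsetP ((AP n).1 x)); rewrite in_band inB => /and3P[+ _ _].
exact: ltW.
Unshelve. all: by end_near.
Qed.
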